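(* Let $\mu>0$. The Hamiltonian associated with the Charlier polynomials, $$\mathfrak{h}_1^C(s)=-\sqrt{s\mu}\,e^{-\partial_s}-\sqrt{(s+1)\mu}\,e^{\partial_s}+(s+\mu)I,$$ satisfies $$\mathfrak{h}_1^C(s)\Phi_n^C(s)=n\,\Phi_n^C(s),\qquad \Phi_n^C(s)=\sqrt{\frac{e^{-\mu}\mu^{s-n}}{s!\,n!}}\;C_n^\mu(s),\qquad n=0,1,2,\dots.$$ Furthermore, the operators $$\mathfrak{a}^{\downarrow}_0(s)=\sqrt{s+1}\,e^{\partial_s}-\sqrt{\mu}\,I,\qquad \mathfrak{a}^{\uparrow}_0(s)=\sqrt{s}\,e^{-\partial_s}-\sqrt{\mu}\,I$$ are such that $\mathfrak{h}_1^C(s)=\mathfrak{a}^{\uparrow}_0(s)\mathfrak{a}^{\downarrow}_0(s)$ and $[\mathfrak{a}^{\downarrow}_0(s),\mathfrak{a}^{\uparrow}_0(s)]=\mathfrak{a}^{\downarrow}_0(s)\mathfrak{a}^{\uparrow}_0(s)-\mathfrak{a}^{\uparrow}_0(s)\mathfrak{a}^{\downarrow}_0(s)=I$.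
   Context: $C_n^\mu$ denotes the monic Charlier polynomial of degree $n$, $$C_n^\mu(x)=(-\mu)^n\sum_{k=0}^{n}\frac{(-n)_k(-x)_k}{k!}\left(-\frac1\mu\right)^k,$$ where $(a)_0=1$ and $(a)_k=a(a+1)\cdots(a+k-1)$. The shift operators are $e^{\pm\partial_s}f(s)=f(s\pm1)$, $I$ is the identity operator, functions of $s$ in operator expressions act by multiplication, and products of operators are compositions. The operators act on functions on the lattice $s\in\{0,1,2,\dots\}$; at $s=0$ terms of the form $\sqrt{s}\,f(s-1)$ and $\sqrt{s\mu}\,f(s-1)$ are zero. *)

(* Defs.v *)
From HB Require Import structures.
From mathcomp Require Import all_boot all_order all_algebra.
From mathcomp Require Import all_classical all_reals all_analysis.

Set Implicit Arguments.
Unset Strict Implicit.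
Unset Printing Implicit Defensive.

Import Order.TTheory GRing.Theory Num.Theory.

Local Open Scope ring_scope.

Definition pochhammer (A : nzRingType) (a : A) (k : nat) : A :=
  \prod_(i < k) (a + i%:R).

(* As a polynomial in x: [pochhammer (- 'X) k] is (-x)_k. *)
Definition charlier (R : realType) (mu : R) (n : nat) : {poly R} :=
  (- mu) ^+ n *:
    \sum_(k < n.+1)
       (pochhammer (- n%:R : R) k / k`!%:R * (- mu^-1) ^+ k) *:
         pochhammer (- 'X) k.

(* The exponent s - n may be negative, hence the integer power. *)
Definition Phi (R : realType) (mu : R) (n s : nat) : R :=
  Num.sqrt (expR (- mu) * mu ^ (s%:Z - n%:Z) / (s`!%:R * n`!%:R))
    * (charlier mu n).[s%:R].

Definition lattice_op (R : realType) : Type := (nat -> R) -> (nat -> R).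

Definition forward_shift (R : realType) : lattice_op R :=
  fun f s => f s.+1.

(* The value at s = 0 is immaterial: below, this shift is always multiplied by
   a coefficient that vanishes there. *)
Definition backward_shift (R : realType) : lattice_op R :=
  fun f s => if s is s'.+1 then f s' else 0.

Definition h1 (R : realType) (mu : R) : lattice_op R :=
  fun f s => - Num.sqrt (s%:R * mu) * backward_shift f s
             - Num.sqrt ((s%:R + 1) * mu) * forward_shift f s
             + (s%:R + mu) * f s.

Definition a_down (R : realType) (mu : R) : lattice_op R :=
  fun f s => Num.sqrt (s%:R + 1) * forward_shift f s - Num.sqrt mu * f s.

Definition a_up (R : realType) (mu : R) : lattice_op R :=
  fun f s => Num.sqrt s%:R * backward_shift f s - Num.sqrt mu * f s.

Definition op_commutator (R : realType) (A B : lattice_op R) : lattice_op R :=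
  (A \o B) \- (B \o A).

(* Main.v *)
Require Import Defs.
From HB Require Import structures.
From mathcomp Require Import all_boot all_order all_algebra.
From mathcomp Require Import all_classical all_reals all_analysis.
From mathcomp Require Import ring.

Import Order.TTheory GRing.Theory Num.Theory.

Local Open Scope ring_scope.

(** The factorization and the commutation relation are computed pointwise; the
    lattice sites 0 and s + 1 are treated apart because of the backward shift.

    For the eigenvalue equation, write Phi_n(s) = sqrt(W(s)) C_n(s). The weight
    satisfies W(s+1) = W(s) mu / (s+1), so the square roots in the Hamiltonian
    combine with those of the neighbouring weights into sqrt(W(s)) times the
    coefficients s and mu ([sqrt_weight_forward],
    [sqrt_weight_backward]). What remains is the second order difference
    equation of the Charlier polynomials ([charlier_difference]),
      mu C_n(s+1) + s C_n(s-1) = (s + mu - n) C_n(s).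
    At a lattice point both Pochhammer symbols are, up to sign, falling
    factorials, so C_n is a combination of the s(s-1)...(s-k+1), on which the
    forward and backward differences act simply; the k-th term of the equation
    is then a difference g_k - g_(k+1) and the sum telescopes to zero. *)

Lemma pochhammerN_nat (A : comNzRingType) (n k : nat) :
  pochhammer (- n%:R : A) k = (-1) ^+ k * (n ^_ k)%:R.
Proof.
rewrite /pochhammer; elim: k => [|k IHk].
  by rewrite big_ord0 expr0 ffactn0 mulr1.
rewrite big_ord_recr /= {}IHk ffactnSr natrM exprS.
case: (leqP k n) => [le_kn|lt_nk]; first by rewrite natrB //; ring.
by rewrite ffact_small // !(mulr0, mul0r).
Qed.

Lemma horner_pochhammerNX (A : comNzRingType) (x : A) (k : nat) :
  (pochhammer (- 'X : {poly A}) k).[x] = pochhammer (- x) k.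
Proof.
rewrite /pochhammer horner_prod; apply: eq_bigr => i _.
by rewrite hornerD hornerN hornerX -polyC_natr hornerC.
Qed.

(** In terms of p(s) = s(s-1)...(s-k+1), this is s p(s-1) = (s - k) p(s): up
    to the factor s, the backward difference acts diagonally. It holds for k > s
    too, since p vanishes at the integers below k. *)
Lemma natr_ffact_backward (A : nzRingType) (s k : nat) :
  (s.+1 * s ^_ k)%:R = (s.+1%:R - k%:R) * (s.+1 ^_ k)%:R :> A.
Proof.
rewrite -ffactnS ffactnSr mulnC natrM.
case: (leqP k s.+1) => [le_ks|lt_sk]; first by rewrite natrB.
by rewrite ffact_small // !mulr0.
Qed.

(** Dually, the forward difference lowers the degree by one. *)
Lemma ffact_forward (s k : nat) :
  s.+1 ^_ k.+1 = (s ^_ k.+1 + k.+1 * s ^_ k)%N.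
Proof.
rewrite ffactnS ffactnSr.
case: (leqP k s) => [le_ks|lt_sk]; last by rewrite ffact_small // !muln0.
by rewrite [(k.+1 * _)%N]mulnC -mulnDr addnS subnK // mulnC.
Qed.

Section Charlier.

Variables (R : realType) (mu : R).
Hypothesis hmu : 0 < mu.

(** The coefficient of s(s-1)...(s-k+1) in the unnormalized Charlier
    polynomial; the signs of the two Pochhammer symbols cancel. *)
Definition charlier_coef (n k : nat) : R :=
  (n ^_ k)%:R / k`!%:R * (- mu^-1) ^+ k.

Lemma charlier_nat (n s : nat) :
  (charlier mu n).[s%:R] =
    (- mu) ^+ n * \sum_(k < n.+1) charlier_coef n k * (s ^_ k)%:R.
Proof.
rewrite /charlier hornerZ horner_sum; congr (_ * _).
apply: eq_bigr => k _.
rewrite hornerZ horner_pochhammerNX !pochhammerN_nat /charlier_coef.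
by rewrite -[RHS](signrMK k); ring.
Qed.

Lemma charlier_coefS (n k : nat) :
  mu * k.+1%:R * charlier_coef n k.+1 = - (n%:R - k%:R) * charlier_coef n k.
Proof.
have mu_neq0 : mu != 0 by rewrite gt_eqF.
have kf_neq0 : k`!%:R != 0 :> R by rewrite pnatr_eq0 -lt0n fact_gt0.
have k1_neq0 : k.+1%:R != 0 :> R by rewrite pnatr_eq0.
rewrite /charlier_coef ffactnSr factS !natrM exprS.
case: (leqP k n) => [le_kn|lt_nk].
  by rewrite natrB //; field; rewrite mu_neq0 kf_neq0 nat1r k1_neq0.
by rewrite ffact_small // !(mul0r, mulr0).
Qed.

(** The truncated predecessor at s = 0 is harmless because of the factor s.
    Expanding in falling factorials, the k-th term is g k - g k.+1: the forward
    difference contributes g k, and the recurrence for the coefficients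
    identifies what the backward difference and the eigenvalue contribute,
    namely (n - k) times the k-th term of C_n, with - g k.+1. *)
Lemma charlier_difference (n s : nat) :
  s%:R * (charlier mu n).[s.-1%:R] + mu * (charlier mu n).[s.+1%:R] =
    (s%:R + mu - n%:R) * (charlier mu n).[s%:R].
Proof.
pose g k := k%:R * mu * charlier_coef n k * (s ^_ k.-1)%:R.
have gS k : g k.+1 = - (n%:R - k%:R) * charlier_coef n k * (s ^_ k)%:R.
  by rewrite /g /= -charlier_coefS; ring.
have back k : s%:R * (s.-1 ^_ k)%:R = (s%:R - k%:R) * (s ^_ k)%:R :> R.
  case: s {g gS} => [|s]; last by rewrite -natr_ffact_backward natrM.
  by case: k => [|k]; rewrite ?ffact0n !(mul0r, mulr0, subr0).
have term k : s%:R * (charlier_coef n k * (s.-1 ^_ k)%:R)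
    + mu * (charlier_coef n k * (s.+1 ^_ k)%:R)
    - (s%:R + mu - n%:R) * (charlier_coef n k * (s ^_ k)%:R) = g k - g k.+1.
  have fwd : (s.+1 ^_ k)%:R = (s ^_ k)%:R + k%:R * (s ^_ k.-1)%:R :> R.
    by case: k => [|k]; rewrite ?mul0r ?addr0 //= ffact_forward natrD natrM.
  by rewrite gS fwd mulrCA back /g; ring.
apply/eqP; rewrite -subr_eq0 !charlier_nat.
rewrite ![_ * ((- mu) ^+ n * _)]mulrCA -mulrDr -mulrBr !mulr_sumr.
rewrite -big_split /= -sumrB (eq_bigr (fun k : 'I_n.+1 => g k - g k.+1)) //.
(* both ends vanish: g 0 by its factor k, g n.+1 by the factor n - k *)
rewrite -(big_mkord xpredT (fun k => g k - g k.+1)).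
rewrite (eq_bigr (fun k => - (g k.+1 - g k))) => [|k _]; last by rewrite opprB.
by rewrite sumrN telescope_sumr // gS /g subrr oppr0 !mul0r subrr oppr0 mulr0.
Qed.

Definition weight (n s : nat) : R :=
  expR (- mu) * mu ^ (s%:Z - n%:Z) / (s`!%:R * n`!%:R).

Lemma weightS (n s : nat) : s.+1%:R * weight n s.+1 = mu * weight n s.
Proof.
have mu_neq0 : mu != 0 by rewrite gt_eqF.
have f_neq0 m : m`!%:R != 0 :> R by rewrite pnatr_eq0 -lt0n fact_gt0.
have s1_neq0 : s.+1%:R != 0 :> R by rewrite pnatr_eq0.
rewrite /weight (_ : s.+1%:Z - n%:Z = 1 + (s%:Z - n%:Z)); last first.
  by rewrite -addn1 PoszD; ring.
rewrite expfzDr // expr1z factS natrM.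
by field; rewrite !f_neq0 nat1r s1_neq0.
Qed.

(** Multiplying (s+1) W(s+1) = mu W(s) by mu, or for the backward shift by
    s + 1, turns one side into a perfect square times a weight. *)
Lemma sqrt_weight_forward (n s : nat) :
  Num.sqrt (s.+1%:R * mu) * Num.sqrt (weight n s.+1)
  = mu * Num.sqrt (weight n s).
Proof.
have mu_ge0 := ltW hmu.
rewrite -sqrtrM ?mulr_ge0 // mulrAC weightS mulrAC -expr2.
by rewrite sqrtrM ?sqr_ge0 // sqrtr_sqr ger0_norm.
Qed.

Lemma sqrt_weight_backward (n s : nat) :
  Num.sqrt (s.+1%:R * mu) * Num.sqrt (weight n s)
  = s.+1%:R * Num.sqrt (weight n s.+1).
Proof.
have mu_ge0 := ltW hmu.
rewrite -sqrtrM ?mulr_ge0 // -mulrA -weightS mulrA -expr2.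
by rewrite sqrtrM ?sqr_ge0 // sqrtr_sqr ger0_norm.
Qed.

Lemma h1_Phi (n s : nat) : h1 mu (Phi mu n) s = n%:R * Phi mu n s.
Proof.
have PhiE m : Phi mu n m = Num.sqrt (weight n m) * (charlier mu n).[m%:R] by [].
have back : Num.sqrt (s%:R * mu) * backward_shift (Phi mu n) s
    = Num.sqrt (weight n s) * (s%:R * (charlier mu n).[s.-1%:R]).
  case: s => [|s] /=; first by rewrite !mul0r !mulr0.
  by rewrite PhiE mulrA sqrt_weight_backward; ring.
rewrite /h1 /forward_shift natr1 !mulNr back !PhiE.
rewrite [X in _ - X + _]mulrA sqrt_weight_forward.
have -> : s%:R * (charlier mu n).[s.-1%:R] =
    (s%:R + mu - n%:R) * (charlier mu n).[s%:R] - mu * (charlier mu n).[s.+1%:R].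
  by rewrite -charlier_difference addrK.
by ring.
Qed.

Lemma h1_factorization : h1 mu = a_up mu \o a_down mu.
Proof.
have mu_ge0 := ltW hmu.
apply/funext => f; apply/funext => s.
rewrite /h1 /a_up /a_down /forward_shift /= natr1 !sqrtrM //.
have -> : s%:R + mu = Num.sqrt s%:R ^+ 2 + Num.sqrt mu ^+ 2.
  by rewrite !sqr_sqrtr.
by case: s => [|s] /=; rewrite ?sqrtr0 ?natr1; ring.
Qed.

(** The products of shifts with constants cancel, leaving
    sqrt(s+1) sqrt(s+1) - sqrt(s) sqrt(s) = 1. *)
Lemma commutator_a_down_a_up : op_commutator (a_down mu) (a_up mu) = id.
Proof.
apply/funext => f; apply/funext => s.
change (a_down mu (a_up mu f) s - a_up mu (a_down mu f) s = f s).
rewrite /a_up /a_down /forward_shift /= natr1.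
have sqrt_s m := sqr_sqrtr (ler0n R m).
rewrite [LHS](_ : _ = (Num.sqrt s.+1%:R ^+ 2 - Num.sqrt s%:R ^+ 2) * f s).
  by rewrite !sqrt_s -natr1 addrAC subrr add0r mul1r.
by case: s => [|s] /=; rewrite ?sqrtr0 ?natr1; ring.
Qed.

End Charlier.

Theorem corollary4p2 (R : realType) (mu : R) (hmu : 0 < mu) :
  [/\ forall n s : nat, h1 mu (Phi mu n) s = n%:R * Phi mu n s,
      h1 mu = a_up mu \o a_down mu
    & op_commutator (a_down mu) (a_up mu) = id].
Proof.
split; [exact: h1_Phi | exact: h1_factorization |].
exact: commutator_a_down_a_up.
Qed.
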